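(* Let $A$ be a finite alphabet, let $R\subseteq A^*\times A^*$ be a finite set, and let $R^{\#}$ be the least two-sided congruence on $A^*$ containing $R$. If $S\subseteq A^*\times A^*$ is any finite set, and $\rho$ is the least right congruence on $A^*$ containing $R^{\#}$ and $S$, then the following hold: (a) If a congruence enumeration for $\rho$ terminates with output word graph $\Gamma=(N,E)$, then $A^*/\rho$ is finite and the function $\phi:N\times A^*\to N$, defined by $(\alpha,w)\phi=\beta$ whenever $w$ labels an $(\alpha,\beta)$-path in $\Gamma$, is a right action that is isomorphic to the natural action of $A^*$ on $A^*/\rho$ by right multiplication. (b) If $A^*/\rho$ is finite, then any congruence enumeration for $\rho$ terminates.
   Context: **Words and actions.** The alphabet $A$ is assumed to be totally ordered. $A^*$ is the free monoid on $A$, with empty word $\varepsilon$; $\mathfrak{P}(X)$ is the power set of $X$; $\Delta_X$ is the equality relation on $X$. Functions are written on the right of their arguments. A right action of a monoid $T$ on a set $X$ is a function $\Psi:X\times T\to X$ with $((x,s)\Psi,t)\Psi=(x,st)\Psi$ and $(x,1)\Psi=x$; write $x\cdot s$ for $(x,s)\Psi$. An isomorphism of right actions of $T$ on $X$ and $Y$ is a bijection $\lambda:X\to Y$ with $(x\cdot s)\lambda=(x)\lambda\cdot s$ for all $x\in X$, $s\in T$. The natural action of $A^*$ on $A^*/\rho$ is $u/\rho\cdot v=uv/\rho$. **Word graphs.** A word graph (over $A$) is a digraph $\Gamma=(N,E)$ with $N\subseteq\mathbb{N}=\{0,1,2,\ldots\}$ a finite set of nodes, $0\in N$, and $E\subseteq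 N\times A\times N$ a set of edges; $(\alpha,a,\beta)\in E$ has source $\alpha$, label $a$, target $\beta$. An $(\alpha,\beta)$-path is a (possibly empty) sequence of consecutive edges from $\alpha$ to $\beta$; its source is $\alpha$, its target is $\beta$, and it is labelled by the word of its edge labels. The path relation $\pi_\Gamma:N\to\mathfrak{P}(A^*\times A^* )$ is defined by: $(u,v)\in(\alpha)\pi_\Gamma$ iff there is a node $\beta$ such that $u$ and $v$ both label $(\alpha,\beta)$-paths. For an equivalence $\kappa$ on $N$, the quotient $\Gamma/\kappa$ is the word graph with nodes $\{\min\alpha/\kappa:\alpha\in N\}$ and edges $(\min\alpha/\kappa,a,\min\beta/\kappa)$ whenever $(\alpha,a,\beta)\in E$. **Steps.** The input to the $i$-th step ($i\geq1$) is $(\Gamma_i,\kappa_i)$ with $\Gamma_i=(N_i,E_i)$ a word graph and $\kappa_i$ an equivalence relation on $N_i$; the output is $(\Gamma_{i+1},\kappa_{i+1})$. TC1: If $\alpha\in N_i$ and no edge of $\Gamma_i$ with source $\alpha$ is labelled by $a\in A$, then $\Gamma_{i+1}$ is $\Gamma_i$ with the new node $\beta:=1+\max\bigcup_{j\leq i}N_j$ and the edge $(\alpha,a,\beta)$ added; $\kappa_{i+1}:=\kappa_i\cup\{(\beta,\beta)\}$. TC2: Suppose that $\alpha\in N_i$ and $(u,v)\in R$, where $u=u_1a$ and $v=v_1b$ for some $u_1,v_1\in A^*$ and $a,b\in A$. (a) If $u$ and $v_1$ label paths from $\alpha$ to nodes $\beta,\gamma$ respectively, but $\gamma$ is not the source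 of any edge labelled $b$, then $\Gamma_{i+1}$ is $\Gamma_i$ with the edge $(\gamma,b,\beta)$ added, and $\kappa_{i+1}:=\kappa_i$. (b) The dual of (a): if $u_1$ and $v$ label paths from $\alpha$ to nodes $\beta,\gamma$ respectively, but $\beta$ is not the source of any edge labelled $a$, then the edge $(\beta,a,\gamma)$ is added, and $\kappa_{i+1}:=\kappa_i$. (c) If $u$ and $v$ label paths from $\alpha$ to nodes $\beta,\gamma$ respectively and $\beta\neq\gamma$, then $\Gamma_{i+1}:=\Gamma_i$ and $\kappa_{i+1}$ is the least equivalence containing $\kappa_i$ and $(\beta,\gamma)$. It may be that none of (a), (b), (c) holds, in which case nothing changes. TC3: $\Gamma_{i+1}:=\Gamma_i/\kappa_i$ and $\kappa_{i+1}$ is the least equivalence on $N_{i+1}$ containing every $(\beta,\gamma)$, $\beta\neq\gamma$, for which there are $\alpha\in N_{i+1}$, $a\in A$ with $(\alpha,a,\beta),(\alpha,a,\gamma)\in E_{i+1}$. **Congruence enumeration.** Let $\Gamma_1=(N_1,E_1)$ be a word graph with $(0)\pi_{\Gamma_1}\subseteq\rho$, and let $\kappa_1=\Delta_{N_1}$. A congruence enumeration for $\rho$ with input $(\Gamma_1,\kappa_1)$ consists of: (a) for every $(u,v)\in S$, by repeatedly applying TC1 (if necessary), add edges to $\Gamma_1$ so that it contains paths labelled by $u$ and $v$ both with source $0$; (b) apply TC2 to $0$ and every $(u,v)\in S$ (with $(u,v)$ in the role of the relation). If $(\Gamma_m,\kappa_m)$ is the output of (a) and (b), then the enumeration is concluded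 by performing any sequence of applications of TC1, TC2, TC3 such that for every $i\geq m$: (c) if $\alpha\in N_i$ and there is no edge with source $\alpha$ and label $a\in A$ in $\Gamma_i$, then there is $j\geq i$ such that either $\alpha$ is no longer a node in $\Gamma_j$ or $\Gamma_j$ has an edge with source $\alpha$ and label $a$; (d) if $\alpha\in N_i$ and $(u,v)\in R$, then there is $j\geq i$ such that either $\alpha$ is no longer a node in $\Gamma_j$ or $(u,v)\in(\alpha)\pi_{\Gamma_j}$; (e) if $\kappa_i\neq\Delta_{N_i}$ then there is $j\geq i$ with $\kappa_j=\Delta_{N_j}$. A congruence enumeration terminates if the output $(\Gamma_i,\kappa_i)$ has the property that applying any of TC1, TC2, TC3 to $(\Gamma_i,\kappa_i)$ results in no change, i.e. $(\Gamma_{i+1},\kappa_{i+1})=(\Gamma_i,\kappa_i)$; its output word graph is then $\Gamma_i$.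
   Formalization: Added: every node of the input word graph is reachable from 0; in (b), the input is deterministic or TC3 is applied at least once; TC2 is also applied to pairs containing the empty word. Without each of these the statement as given has counterexamples. *)

(* Defs.v *)
From mathcomp Require Import all_boot all_order.
From mathcomp Require Import generic_quotient finmap.
From mathcomp Require Import boolp classical_sets functions cardinality.

Set Implicit Arguments.
Unset Strict Implicit.
Unset Printing Implicit Defensive.

Local Open Scope quotient_scope.
Local Open Scope fset_scope.

Definition word (A : Type) := seq A.

Section Congruences.
Context {disp : Order.disp_t} {A : finOrderType disp}.
Implicit Types (R S : {fset word A * word A}) (u v w : word A).

Definition equivalence_rel_on_words (rho : word A -> word A -> Prop) :=
  [/\ forall u, rho u u,
      forall u v, rho u v -> rho v u
    & forall u v w, rho u v -> rho v w -> rho u w].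

Definition right_congruence (rho : word A -> word A -> Prop) :=
  equivalence_rel_on_words rho /\
  forall u v w, rho u v -> rho (u ++ w) (v ++ w).

Definition two_sided_congruence (rho : word A -> word A -> Prop) :=
  equivalence_rel_on_words rho /\
  forall u v w w', rho u v -> rho (w ++ u ++ w') (w ++ v ++ w').

Definition sharp R u v : Prop :=
  forall rho, two_sided_congruence rho ->
    (forall x y, (x, y) \in R -> rho x y) -> rho u v.

Definition rcong R S u v : Prop :=
  forall rho, right_congruence rho ->
    (forall x y, sharp R x y -> rho x y) ->
    (forall x y, (x, y) \in S -> rho x y) -> rho u v.

Lemma rcong_right_congruence R S : right_congruence (rcong R S).
Proof.
split; first split.
- by move=> u rho [[rr _ _] _] _ _; apply: rr.
- move=> u v uv rho rc hR hS; case: (rc) => -[_ rs _] _.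
  exact/rs/(uv _ rc hR hS).
- move=> u v w uv vw rho rc hR hS; case: (rc) => -[_ _ rt] _.
  exact: rt (uv _ rc hR hS) (vw _ rc hR hS).
- move=> u v w uv rho rc hR hS; case: (rc) => _ rw.
  exact/rw/(uv _ rc hR hS).
Qed.

(* The generic quotient construction needs a boolean relation; `[< _ >] is
   the (classical) truth value of a proposition. *)
Definition rcongb R S : rel (word A) := fun u v => `[< rcong R S u v >].

Lemma rcongb_refl R S : reflexive (rcongb R S).
Proof. by move=> u; apply/asboolP; case: (rcong_right_congruence R S) => -[]. Qed.

Lemma rcongb_sym R S : symmetric (rcongb R S).
Proof.
have [[_ rs _] _] := rcong_right_congruence R S.
by move=> u v; apply/asboolP/asboolP; apply: rs.
Qed.

Lemma rcongb_trans R S : transitive (rcongb R S).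
Proof.
have [[_ _ rt] _] := rcong_right_congruence R S.
by move=> v u w /asboolP uv /asboolP vw; apply/asboolP; apply: rt uv vw.
Qed.

Definition rcong_equiv R S : equiv_rel (word A) :=
  EquivRel (rcongb R S) (@rcongb_refl R S) (@rcongb_sym R S)
           (@rcongb_trans R S).

Definition word_quot R S := {eq_quot (rcong_equiv R S)}.

Definition natural_action R S (x : word_quot R S) w : word_quot R S :=
  \pi_(word_quot R S) (repr x ++ w).

Lemma word_quot_eq R S u v :
  (\pi_(word_quot R S) u = \pi_(word_quot R S) v) <-> rcong R S u v.
Proof.
split=> [/eqmodP /asboolP //|h]; apply/eqmodP; exact/asboolP.
Qed.

Lemma natural_actionE R S u w :
  natural_action (\pi_(word_quot R S) u) w = \pi_(word_quot R S) (u ++ w).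
Proof.
apply/word_quot_eq; have [_ rw] := rcong_right_congruence R S.
by apply: rw; apply/word_quot_eq; rewrite reprK.
Qed.

Definition right_action (X : Type) (act : X -> word A -> X) :=
  (forall x s t, act (act x s) t = act x (s ++ t)) /\
  (forall x, act x [::] = x).

Definition action_isomorphic (X Y : Type) (actX : X -> word A -> X)
    (actY : Y -> word A -> Y) :=
  exists2 lambda : X -> Y, bijective lambda &
    forall x s, lambda (actX x s) = actY (lambda x) s.

End Congruences.

Record word_graph {disp : Order.disp_t} (A : finOrderType disp) := WordGraph {
  nodes : {fset nat};
  edges : {fset nat * A * nat};
  zero_node : 0 \in nodes;
  edges_in_nodes :
    all (fun e => (e.1.1 \in nodes) && (e.2 \in nodes)) edges
}.

Section ToddCoxeter.
Context {disp : Order.disp_t} {A : finOrderType disp}.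
Implicit Types (G : word_graph A) (K : {fset nat * nat}).
Implicit Types (R S : {fset word A * word A}) (u v w : word A).
Implicit Types (x y z : nat) (a b : A).

Fixpoint labels_path G x w y : Prop :=
  if w is a :: w' then
    exists2 z, (x, a, z) \in edges G & labels_path G z w' y
  else x \in nodes G /\ x = y.

Definition path_relation G x u v : Prop :=
  exists y, labels_path G x u y /\ labels_path G x v y.

Definition has_edge G x a : Prop := exists y, (x, a, y) \in edges G.

(* A word graph given as input may be nondeterministic and may have nodes that
   cannot be reached from 0.  Coincidences already present in the input are
   only detected by TC3, and no step connects an unreachable component to
   0: hence the next two properties. *)
Definition deterministic G : Prop :=
  forall x a y z, (x, a, y) \in edges G -> (x, a, z) \in edges G -> y = z.

Definition reachable_from_zero G : Prop :=
  forall x, x \in nodes G -> exists w, labels_path G 0 w x.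

Definition fdiagonal (N : {fset nat}) : {fset nat * nat} :=
  [fset (x, x) | x in N].

Definition equivalence_on (N : {fset nat}) K :=
  [/\ forall x y, (x, y) \in K -> x \in N /\ y \in N,
      forall x, x \in N -> (x, x) \in K,
      forall x y, (x, y) \in K -> (y, x) \in K
    & forall x y z, (x, y) \in K -> (y, z) \in K -> (x, z) \in K].

Definition least_equivalence (N : {fset nat}) (P : nat -> nat -> Prop) K :=
  [/\ equivalence_on N K,
      forall x y, P x y -> (x, y) \in K
    & forall K', equivalence_on N K' ->
        (forall x y, P x y -> (x, y) \in K') -> K `<=` K'].

Definition class_min K x : nat := \big[minn/x]_(p <- K | p.1 == x) p.2.

Definition is_quotient G K G' : Prop :=
  nodes G' = [fset class_min K x | x in nodes G] /\
  edges G' = [fset (class_min K e.1.1, e.1.2, class_min K e.2) |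
              e in edges G].

Definition state := (word_graph A * {fset nat * nat})%type.
Implicit Types (s t : state).

(* [fresh] is the name of the new node; it depends on all the nodes used so
   far in the enumeration, cf. [new_node]. *)
Definition TC1 (fresh : nat) s t : Prop :=
  exists x a, x \in nodes s.1 /\
  ((has_edge s.1 x a /\ t = s) \/
   [/\ ~ has_edge s.1 x a,
       nodes t.1 = fresh |` nodes s.1,
       edges t.1 = (x, a, fresh) |` edges s.1
     & t.2 = (fresh, fresh) |` s.2]).

Definition TC2a x u v s t : Prop :=
  exists v1 b y z,
    [/\ v = rcons v1 b, labels_path s.1 x u y, labels_path s.1 x v1 z
      & ~ has_edge s.1 z b] /\
    [/\ nodes t.1 = nodes s.1, edges t.1 = (z, b, y) |` edges s.1
      & t.2 = s.2].

Definition TC2b x u v s t : Prop := TC2a x v u s t.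

Definition TC2c x u v s t : Prop :=
  exists y z,
    [/\ labels_path s.1 x u y, labels_path s.1 x v z & y <> z] /\
    t.1 = s.1 /\
    least_equivalence (nodes s.1)
      (fun p q => (p, q) \in s.2 \/ (p = y /\ q = z)) t.2.

(* Only (a) uses a last letter of v and only (b) a last letter of u, so that
   pairs involving the empty word are covered as well. *)
Definition TC2abc x u v s t : Prop :=
  [\/ TC2a x u v s t, TC2b x u v s t | TC2c x u v s t].

Definition TC2 x u v s t : Prop :=
  x \in nodes s.1 /\
  (TC2abc x u v s t \/ ((forall t', ~ TC2abc x u v s t') /\ t = s)).

Definition TC3 s t : Prop :=
  is_quotient s.1 s.2 t.1 /\
  least_equivalence (nodes t.1)
    (fun y z => y <> z /\ exists x a,
       (x, a, y) \in edges t.1 /\ (x, a, z) \in edges t.1) t.2.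

Definition TC_step R (fresh : nat) s t : Prop :=
  [\/ TC1 fresh s t,
      exists x u v, (u, v) \in R /\ TC2 x u v s t
    | TC3 s t].

Definition new_node (st : nat -> state) (i : nat) : nat :=
  (\max_(j < i.+1) \max_(x <- nodes (st j).1) x).+1.

(* The states are numbered from 0: [st 0] is the input.  A sequence of steps
   is infinite; one that stops in a state that no step changes is continued
   by repeating that state, which is an application of TC3.  The states
   [st 0], ..., [st m] cover the initial phase, where TC2 is applied at the
   node 0 to the elements of S in an arbitrary order. *)
Definition congruence_enumeration R S (m : nat) (st : nat -> state) : Prop :=
  [/\ (forall u v, path_relation (st 0).1 0 u v -> rcong R S u v) /\
      (st 0).2 = fdiagonal (nodes (st 0).1),
      exists (p : nat) (l : seq (word A * word A)),
        [/\ forall i, i < p -> TC1 (new_node st i) (st i) (st i.+1),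
            forall u v, (u, v) \in S -> exists y z,
              labels_path (st p).1 0 u y /\ labels_path (st p).1 0 v z,
            perm_eq l S,
            m = (p + size l)%N
          & forall k, k < size l ->
              let uv := nth ([::], [::]) l k in
              TC2 0 uv.1 uv.2 (st (p + k)%N) (st (p + k)%N.+1)],
      forall i, m <= i -> TC_step R (new_node st i) (st i) (st i.+1)
    & forall i, m <= i ->
      [/\ forall x a, x \in nodes (st i).1 -> ~ has_edge (st i).1 x a ->
            exists2 j, i <= j &
              x \notin nodes (st j).1 \/ has_edge (st j).1 x a,
          forall x u v, x \in nodes (st i).1 -> (u, v) \in R ->
            exists2 j, i <= j &
              x \notin nodes (st j).1 \/ path_relation (st j).1 x u v
        & (st i).2 <> fdiagonal (nodes (st i).1) ->
            exists2 j, i <= j & (st j).2 = fdiagonal (nodes (st j).1)]].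

Definition terminates_at R (m : nat) (st : nat -> state) (i : nat) : Prop :=
  m <= i /\ forall t, TC_step R (new_node st i) (st i) t -> t = st i.

End ToddCoxeter.

Arguments state {disp} A.

(* Main.v *)
(* A homomorphism f from the current word graph to the Cayley graph of A*/rho,
   compatible with the pending identifications, survives every step.  A state
   that no step changes is a complete deterministic word graph without pending
   identifications in which R holds at every node, so words act on its nodes;
   since the pairs in S stay identified at 0, the universal property of A*/rho
   gives an equivariant inverse of f.

   For termination, call a node immortal when it is never merged into a smaller
   one.  Merging only decreases node numbers, so the target of a path from an
   immortal node is eventually constant.  Fairness, together with the fact that
   the equivalence is trivial infinitely often, makes words act on the immortal
   nodes, and the relations of R and S hold there.  By the universal property
   the finite graph A*/rho maps into the immortal nodes, and its image is a
   subgraph from some time on.  When the equivalence is next trivial the word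
   graph is deterministic, hence, being reachable from 0, equal to this image,
   and no step changes it. *)
Require Import Defs.
From mathcomp Require Import all_boot all_order.
From mathcomp Require Import generic_quotient finmap.
From mathcomp Require Import boolp classical_sets functions cardinality.

Set Implicit Arguments.
Unset Strict Implicit.
Unset Printing Implicit Defensive.

Local Open Scope quotient_scope.
Local Open Scope fset_scope.

(** * Finite equivalence relations on sets of nodes, and class minima *)

Section EquivalenceOn.
Implicit Types (N : {fset nat}) (K : {fset nat * nat}) (x y : nat).

Lemma mem_fdiagonal N x y : ((x, y) \in fdiagonal N) = (x \in N) && (x == y).
Proof.
apply/imfsetP/andP => /= [[z zN [-> ->]]//|[xN /eqP <-]].
by exists x.
Qed.

Lemma fdiagonal_equivalence N : equivalence_on N (fdiagonal N).
Proof.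
split=> [x y|x xN|x y|x y z]; rewrite !mem_fdiagonal ?xN ?eqxx//.
- by case/andP => xN /eqP <-.
- by case/andP => xN /eqP <-; rewrite xN eqxx.
- by case/andP => xN /eqP <-.
Qed.

Lemma fdiagonal_sub N K : equivalence_on N K -> fdiagonal N `<=` K.
Proof.
case=> _ r _ _; apply/fsubsetP => -[x y].
by rewrite mem_fdiagonal => /andP[xN /eqP <-]; apply: r.
Qed.

(** The intersection of all equivalences on [N] containing [P], cut out of the finite square of [N].
    The steps TC2 and TC3 are relations between states, so outputs have to be built when a step is
    to be performed. *)
Lemma least_equivalence_exists N (P : nat -> nat -> Prop) :
  (forall x y, P x y -> x \in N /\ y \in N) ->
  exists K, least_equivalence N P K.
Proof.
move=> PN.
pose gen (p : nat * nat) := `[< forall K', equivalence_on N K' ->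
  (forall x y, P x y -> (x, y) \in K') -> p \in K' >].
exists [fset p in N `*` N | gen p].
have memE x y : (x, y) \in [fset p in N `*` N | gen p] =
    [&& x \in N, y \in N & gen (x, y)].
  by rewrite !inE /= -andbA.
split.
- split=> [x y|x xN|x y|x y z]; rewrite !memE.
  + by case/and3P.
  + by rewrite xN /=; apply/asboolP => K' [_ r _ _] _; apply: r.
  + case/and3P=> -> -> /asboolP xy /=; apply/asboolP => K' K'eq PK'.
    by case: (K'eq) => _ _ s _; apply: s; apply: xy.
  + case/and3P=> -> _ /asboolP xy /and3P[_ -> /asboolP yz] /=.
    apply/asboolP => K' K'eq PK'; case: (K'eq) => _ _ _ tr.
    by apply: (tr _ y); [apply: xy | apply: yz].
- move=> x y xy; rewrite memE; have [-> ->] := PN _ _ xy.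
  by apply/asboolP => K' _; apply.
- move=> K' K'eq PK'; apply/fsubsetP => -[x y]; rewrite memE.
  by case/and3P => _ _ /asboolP; apply.
Qed.

Lemma least_equivalence_eq N P K K' :
  least_equivalence N P K -> least_equivalence N P K' -> K = K'.
Proof.
move=> [e h l] [e' h' l']; apply/eqP.
by rewrite eqEfsubset l// l'.
Qed.

(** The kernel of [f] on [N] is itself an equivalence containing [P], so it contains the least
    one. *)
Lemma least_equivalence_kernel (T : choiceType) (f : nat -> T) N P K :
  least_equivalence N P K -> (forall x y, P x y -> x \in N /\ y \in N) ->
  (forall x y, P x y -> f x = f y) ->
  forall x y, (x, y) \in K -> f x = f y.
Proof.
move=> [Keq _ least] PN Pf.
have memE x y : (x, y) \in [fset p in N `*` N | f p.1 == f p.2] =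
    [&& x \in N, y \in N & f x == f y].
  by rewrite !inE /= -andbA.
have /fsubsetP sub : K `<=` [fset p in N `*` N | f p.1 == f p.2].
  apply: least => [|x y xy]; last first.
    by rewrite memE; have [-> ->] := PN _ _ xy; rewrite (Pf _ _ xy) eqxx.
  split=> [x y|x xN|x y|x y z]; rewrite !memE.
  - by case/and3P.
  - by rewrite xN eqxx.
  - by case/and3P=> -> -> /eqP ->; rewrite eqxx.
  - by case/and3P=> -> _ /eqP -> /and3P[_ -> ->].
by move=> x y /sub; rewrite memE => /and3P[_ _ /eqP].
Qed.

(** [x] is the default value of the iterated minimum, so it bounds the result. In particular 0 is
    always its own class minimum. *)
Lemma class_min_le_self K x : class_min K x <= x.
Proof.
rewrite /class_min; elim/big_rec: _ => // p m _ mx.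
by rewrite (leq_trans (geq_minr _ _)).
Qed.

Lemma class_min_le K x y : (x, y) \in K -> class_min K x <= y.
Proof.
rewrite /class_min -[(x, y) \in K]/((x, y) \in (K : seq _)).
elim: (K : seq _) => [|p s IHs] //; rewrite inE big_cons.
case/predU1P => [<-|/IHs le] /=; first by rewrite eqxx geq_minl.
by case: ifP => // _; rewrite (leq_trans (geq_minr _ _)).
Qed.

Lemma class_min_mem N K x :
  equivalence_on N K -> x \in N -> (x, class_min K x) \in K.
Proof.
move=> [_ r _ _] xN; rewrite /class_min big_seq_cond.
elim/big_rec: _ => [|[y z] m /andP[yzK /= /eqP yx] mK]; first exact: r.
by rewrite yx in yzK; rewrite /minn; case: ifP.
Qed.

Lemma class_min_eq N K x y :
  equivalence_on N K -> (x, y) \in K -> class_min K x = class_min K y.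
Proof.
move=> Keq xy; have [mem _ sym tr] := Keq; have [xN yN] := mem _ _ xy.
apply/eqP; rewrite eqn_leq !class_min_le//.
- exact: tr (sym _ _ xy) (class_min_mem Keq xN).
- exact: tr xy (class_min_mem Keq yN).
Qed.

Lemma class_min_idem N K x y :
  equivalence_on N K -> x \in N -> y = class_min K x -> class_min K y = y.
Proof.
by move=> Keq xN ->; rewrite -(class_min_eq Keq (class_min_mem Keq xN)).
Qed.

Lemma class_min_fdiagonal N x : x \in N -> class_min (fdiagonal N) x = x.
Proof.
move=> /(class_min_mem (fdiagonal_equivalence N)).
by rewrite mem_fdiagonal => /andP[_ /eqP <-].
Qed.

End EquivalenceOn.

(** * Paths in word graphs and quotient graphs *)

Section WordGraphs.
Context {disp : Order.disp_t} {A : finOrderType disp}.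
Implicit Types (G H : word_graph A) (K : {fset nat * nat}).
Implicit Types (u v w : word A) (x y z : nat) (a b : A).

Lemma word_graph_eq G H : nodes G = nodes H -> edges G = edges H -> G = H.
Proof.
case: G H => [N E z e] [N' E' z' e'] /= NN' EE'.
subst N' E'; by rewrite (bool_irrelevance z z') (bool_irrelevance e e').
Qed.

Lemma edge_nodes G x a y :
  (x, a, y) \in edges G -> x \in nodes G /\ y \in nodes G.
Proof. by move=> xay; have /andP[] := allP (edges_in_nodes G) _ xay. Qed.

Lemma labels_path_nodes G x w y :
  labels_path G x w y -> x \in nodes G /\ y \in nodes G.
Proof.
elim: w x => [|a w IHw] x /= => [[xN <-]//|[z xz /IHw[_ yN]]].
by have [] := edge_nodes xz.
Qed.

Lemma labels_path_cat G x u v y :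
  labels_path G x (u ++ v) y <->
  exists2 z, labels_path G x u z & labels_path G z v y.
Proof.
elim: u x => [|a u IHu] x /=.
  by split=> [xy|[z [_ <-]]//]; exists x => //; have [] := labels_path_nodes xy.
split=> [[z xz /IHu[z' zz' z'y]]|[z' [z xz zz'] z'y]].
  by exists z' => //; exists z.
by exists z => //; apply/IHu; exists z'.
Qed.

Lemma labels_path1 G x a y :
  labels_path G x [:: a] y <-> (x, a, y) \in edges G.
Proof.
split=> [[z xz [_ <-]]//|xy]; exists y => //; split=> //.
by have [] := edge_nodes xy.
Qed.

Lemma labels_path_rcons G x w a z y :
  labels_path G x w z -> (z, a, y) \in edges G ->
  labels_path G x (rcons w a) y.
Proof.
by move=> xz zy; rewrite -cats1; apply/labels_path_cat; exists z => //;
   apply/labels_path1.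
Qed.

Lemma labels_path_det G x w y z :
  deterministic G -> labels_path G x w y -> labels_path G x w z -> y = z.
Proof.
move=> det; elim: w x => [|a w IHw] x /= => [[_ <-] [_ <-]//|].
by move=> [y' xy' y'y] [z' xz']; rewrite -(det _ _ _ _ xy' xz'); apply: IHw.
Qed.

Lemma labels_path_map G H (g : nat -> nat) x w y :
  (forall z, z \in nodes G -> g z \in nodes H) ->
  (forall z a z', (z, a, z') \in edges G -> (g z, a, g z') \in edges H) ->
  labels_path G x w y -> labels_path H (g x) w (g y).
Proof.
move=> gN gE; elim: w x => [|a w IHw] x /= => [[xN <-]|[z xz zy]].
  by split; first exact: gN.
by exists (g z); [apply: gE | apply: IHw].
Qed.

Lemma labels_path_sub G H x w y : nodes G `<=` nodes H ->
  edges G `<=` edges H -> labels_path G x w y -> labels_path H x w y.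
Proof.
move=> /fsubsetP NN /fsubsetP EE.
by move=> xy; apply: (labels_path_map (g := id)) xy => [z|z a z'];
   [apply: NN | apply: EE].
Qed.

Definition complete G := forall x a, x \in nodes G -> has_edge G x a.

Lemma complete_path G x w :
  complete G -> x \in nodes G -> exists y, labels_path G x w y.
Proof.
move=> cG; elim: w x => [|a w IHw] x xN; first by exists x.
have [z xz] := cG x a xN; have [_ zN] := edge_nodes xz.
by have [y zy] := IHw z zN; exists y, z.
Qed.

Lemma quotient_exists G K :
  equivalence_on (nodes G) K -> exists H, is_quotient G K H.
Proof.
move=> Keq.
pose N := [fset class_min K x | x in nodes G].
pose E := [fset (class_min K e.1.1, e.1.2, class_min K e.2) | e in edges G].
have N0 : 0 \in N.
  apply/imfsetP; exists 0; first exact: zero_node.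
  by apply/esym/eqP; rewrite -leqn0 class_min_le_self.
have EN : all (fun e => (e.1.1 \in N) && (e.2 \in N)) E.
  apply/allP => _ /imfsetP[[[x a] y] /= /edge_nodes[xN yN] ->] /=.
  by rewrite !in_imfset.
by exists (WordGraph N0 EN).
Qed.

Lemma quotient_edgeP G K H x a y : is_quotient G K H ->
  (x, a, y) \in edges H <->
  exists x' y', [/\ (x', a, y') \in edges G, x = class_min K x'
                  & y = class_min K y'].
Proof.
move=> [_ ->]; split=> [/imfsetP[[[x' b] y'] /= xy' [-> -> ->]]|].
  by exists x', y'.
move=> [x' [y' [xy' -> ->]]]; apply/imfsetP.
by exists (x', a, y').
Qed.

Lemma quotient_nodeP G K H x : is_quotient G K H ->
  x \in nodes H <-> exists2 x', x' \in nodes G & x = class_min K x'.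
Proof.
by move=> [-> _]; split=> [/imfsetP[x' ? ->]|[x' ? ->]];
   [exists x' | rewrite in_imfset].
Qed.

End WordGraphs.

(** * Invariants of a single step, and the states that no step changes *)

Section Steps.
Context {disp : Order.disp_t} {A : finOrderType disp}.
Implicit Types (G H : word_graph A) (K : {fset nat * nat}) (s t : state A).
Implicit Types (R S : {fset word A * word A}) (Q : nat -> word A -> word A -> Prop).
Implicit Types (u v w : word A) (x y z : nat) (a b : A) (fresh : nat).

(* [Q x u v] says that TC2 may be applied to the node [x] and the pair
   [(u, v)]: at every node for R, at the node 0 only for S. *)
Variant enum_step Q fresh s t : Prop :=
  | EnumNone of t = s
  | EnumNode x a of x \in nodes s.1 & ~ has_edge s.1 x a &
      nodes t.1 = fresh |` nodes s.1 &
      edges t.1 = (x, a, fresh) |` edges s.1 &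
      t.2 = (fresh, fresh) |` s.2
  | EnumEdge x u v b y z of Q x u (rcons v b) \/ Q x (rcons v b) u &
      labels_path s.1 x u y & labels_path s.1 x v z & ~ has_edge s.1 z b &
      nodes t.1 = nodes s.1 & edges t.1 = (z, b, y) |` edges s.1 &
      t.2 = s.2
  | EnumCoincidence x u v y z of Q x u v & labels_path s.1 x u y &
      labels_path s.1 x v z & t.1 = s.1 &
      least_equivalence (nodes s.1)
        (fun p q => (p, q) \in s.2 \/ (p = y /\ q = z)) t.2
  | EnumQuotient of TC3 s t.

Definition admissible R S x u v := (u, v) \in R \/ x = 0 /\ (u, v) \in S.

Lemma TC1_enum_step Q fresh s t : TC1 fresh s t -> enum_step Q fresh s t.
Proof.
move=> [x [a [xN [[_ ->]|[xa tN tE tK]]]]]; first exact: EnumNone.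
exact: (EnumNode _ xN xa tN tE tK).
Qed.

Lemma TC2_enum_step Q fresh s t x u v :
  Q x u v -> TC2 x u v s t -> enum_step Q fresh s t.
Proof.
move=> Qxuv [xN [[]|[_ ->]]]; last exact: EnumNone.
- move=> [v1 [b [y [z [[vE xu xv nz] [tN tE tK]]]]]].
  by apply: (EnumEdge _ _ xu xv nz tN tE tK); left; rewrite -vE.
- move=> [v1 [b [y [z [[vE xu xv nz] [tN tE tK]]]]]].
  by apply: (EnumEdge _ _ xu xv nz tN tE tK); right; rewrite -vE.
- by move=> [y [z [[xu xv _] [tG tK]]]]; apply: (EnumCoincidence _ Qxuv xu xv).
Qed.

(** Indices below [p] form the TC1 phase, the next [size l] ones apply TC2 to the pairs in S, and
    the rest are free steps. Covering the three ranges at once lets each invariant be proved by one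
    induction. *)
Lemma enumeration_step R S m st i : congruence_enumeration R S m st ->
  enum_step (admissible R S) (new_node st i) (st i) (st i.+1).
Proof.
move=> [_ [p [l [hTC1 _ /perm_mem lS -> hTC2]]] steps _].
have [ip|pi] := ltnP i p; first exact/TC1_enum_step/hTC1.
have [il|li] := ltnP i (p + size l).
  rewrite -(subnKC pi); have kl : i - p < size l by rewrite ltn_subLR.
  apply: TC2_enum_step (hTC2 _ kl); right; split=> //.
  by rewrite -lS -surjective_pairing mem_nth.
have [h|[x [u [v [uvR h]]]]|h] := steps _ li; first exact: TC1_enum_step.
  by apply: TC2_enum_step h; left.
exact: EnumQuotient.
Qed.

(** The pairs from which TC3 generates its new equivalence, together with the trivial ones
    [y = z]. *)
Definition ambiguous G y z :=
  exists x a, (x, a, y) \in edges G /\ (x, a, z) \in edges G.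

Lemma ambiguous_nodes G y z :
  ambiguous G y z -> y \in nodes G /\ z \in nodes G.
Proof.
by move=> [x [a [/edge_nodes[_ yN] /edge_nodes[_ zN]]]].
Qed.

Lemma enum_step_equivalence Q fresh s t : enum_step Q fresh s t ->
  equivalence_on (nodes s.1) s.2 -> equivalence_on (nodes t.1) t.2.
Proof.
case=> [->//|x a _ _ -> _ ->|x u v b y z _ _ _ _ -> _ ->//
  |x u v y z _ _ _ -> []//|[_ []]//].
move=> [mem r sym tr].
have memE p q : ((p, q) \in (fresh, fresh) |` s.2) =
    (p == fresh) && (q == fresh) || ((p, q) \in s.2).
  by rewrite !inE xpair_eqE.
split=> [p q|p|p q|p q o]; rewrite !memE ?inE.
- by case/orP => [/andP[-> ->]//|/mem[-> ->]]; rewrite !orbT.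
- by case/orP => [->//|/r ->]; rewrite orbT.
- by case/orP => [/andP[-> ->]//|/sym ->]; rewrite orbT.
- case/orP => [/andP[/eqP -> /eqP ->]//|pq].
  case/orP => [/andP[/eqP qE /eqP ->]|/(tr _ _ _ pq) ->]; last by rewrite orbT.
  by rewrite qE in pq; rewrite pq orbT.
Qed.

(** The map is the identity except for TC3, where it is [class_min]; a node that survives TC3 is a
    class minimum and so stays fixed. Composing these maps follows a node through the
    enumeration. *)
Lemma enum_step_map Q fresh s t :
  equivalence_on (nodes s.1) s.2 -> enum_step Q fresh s t ->
  exists g : nat -> nat,
    [/\ forall x, g x <= x,
        forall x, x \in nodes s.1 -> g x \in nodes t.1,
        forall x a y, (x, a, y) \in edges s.1 -> (g x, a, g y) \in edges t.1,
        forall x y, (x, y) \in s.2 -> (g x, g y) \in t.2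
      & forall x, x \in nodes s.1 -> x \in nodes t.1 -> g x = x].
Proof.
move=> Keq st; have Keq' := enum_step_equivalence st Keq.
case: st => [->|x a _ _ -> -> ->|x u v b y z _ _ _ _ -> -> ->
  |x u v y z _ _ _ -> [_ + _]|[Gq _]].
- by exists id.
- by exists id; split=> // [p|p c q|p q] h; rewrite !inE h orbT.
- by exists id; split=> // [p c q] h; rewrite !inE h orbT.
- by move=> h; exists id; split=> // p q pq; apply: h; left.
- exists (class_min s.2); split=> [x|x xN|x a y xy|x y xy|x xN].
  + exact: class_min_le_self.
  + by apply/(quotient_nodeP _ Gq); exists x.
  + by apply/(quotient_edgeP _ _ _ Gq); exists x, y.
  + rewrite -(class_min_eq Keq xy); case: Keq' => _ + _ _; apply.
    have [mem _ _ _] := Keq; have [xN _] := mem _ _ xy.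
    by apply/(quotient_nodeP _ Gq); exists x.
  + by move=> /(quotient_nodeP _ Gq)[y yN]; apply: class_min_idem Keq yN.
Qed.

Lemma enum_step_reachable Q fresh s t :
  equivalence_on (nodes s.1) s.2 -> enum_step Q fresh s t ->
  reachable_from_zero s.1 -> reachable_from_zero t.1.
Proof.
move=> Keq st rs y yt.
have [g [gle gN gE _ _]] := enum_step_map Keq st.
have g0 : g 0 = 0 by apply/eqP; rewrite -leqn0.
have old x : x \in nodes s.1 -> exists w, labels_path t.1 0 w (g x).
  by move=> /rs[w xw]; exists w; rewrite -[0]g0; apply: labels_path_map xw.
case: st yt => [->|x a xs _ tN tE _|x u v b p q _ _ _ _ tN tE _
  |x u v p q _ _ _ -> _|[Gq _]] yt.
- exact: rs.
- move: yt; rewrite tN !inE => /predU1P[->|/rs[w yw]].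
    have [w xw] := rs x xs; exists (rcons w a).
    apply: (@labels_path_rcons _ _ _ _ _ _ x); last by rewrite tE fset1U1.
    by apply: labels_path_sub xw; rewrite ?tN ?tE fsubsetUr.
  by exists w; apply: labels_path_sub yw; rewrite ?tN ?tE fsubsetUr.
- move: yt; rewrite tN => /rs[w yw].
  by exists w; apply: labels_path_sub yw; rewrite ?tN ?tE ?fsubsetUr.
- exact: rs.
- move: yt => /(quotient_nodeP _ Gq)[x /rs[w xw] ->]; exists w.
  have -> : 0 = class_min s.2 0.
    by apply/esym/eqP; rewrite -leqn0 class_min_le_self.
  apply: labels_path_map xw => [z zN|z a z' zz'].
    by apply/(quotient_nodeP _ Gq); exists z.
  by apply/(quotient_edgeP _ _ _ Gq); exists z, z'.
Qed.

(** Determinism can be lost in a quotient. This weaker property persists: every ambiguity is already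
    pending in the equivalence. It amounts to determinism once the equivalence is trivial. *)
Definition detects_coincidences s :=
  forall y z, ambiguous s.1 y z -> (y, z) \in s.2.

Lemma enum_step_detects Q fresh s t :
  equivalence_on (nodes s.1) s.2 -> enum_step Q fresh s t ->
  detects_coincidences s -> detects_coincidences t.
Proof.
move=> Keq st ds; have [_ r' _ _] := enum_step_equivalence st Keq.
(* An edge is added only where its source has no edge with that label, so the only ambiguous pair it
   contributes is the diagonal pair at its target. *)
have new_edge p a q (E : {fset nat * A * nat}) y z :
    E = edges s.1 -> ~ has_edge s.1 p a -> (q, q) \in t.2 ->
    (forall y z, (y, z) \in s.2 -> (y, z) \in t.2) ->
    (exists x b, (x, b, y) \in (p, a, q) |` E /\
                 (x, b, z) \in (p, a, q) |` E) -> (y, z) \in t.2.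
  move=> -> npa qq sub [x [b []]]; rewrite !inE.
  case/predU1P => [[-> -> ->]|xy].
    case/predU1P => [[->]//|xz]; by case: npa; exists z.
  case/predU1P => [[xE bE _]|xz]; last by apply/sub/ds; exists x, b.
  by case: npa; exists y; rewrite -xE -bE.
case: st r' => [->//|x a xN xa tN tE tK|x u v b p q _ xu xv nqb tN tE tK
  |x u v p q _ _ _ tG [_ sub _]|[Gq [_ sub _]]] r' y z.
- rewrite /ambiguous tE; apply: new_edge => //.
    by apply: r'; rewrite tN fset1U1.
  by move=> ? ?; rewrite tK !inE => ->; rewrite orbT.
- rewrite /ambiguous tE; apply: new_edge => //; last by rewrite tK.
  by apply: r'; rewrite tN; have [] := labels_path_nodes xu.
- by rewrite tG => /ds h; apply: sub; left.
- have [<-|/eqP yz] := eqVneq y z; last by move=> h; apply: sub; split.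
  by move=> /ambiguous_nodes[yN _]; apply: r'.
Qed.

Lemma TC3_detects s t : TC3 s t -> detects_coincidences t.
Proof.
move=> [_ [[_ r _ _] sub _]] y z; have [<-|/eqP yz] := eqVneq y z.
  by move=> /ambiguous_nodes[yN _]; apply: r.
by move=> h; apply: sub.
Qed.

Lemma detects_deterministic s :
  detects_coincidences s -> s.2 = fdiagonal (nodes s.1) -> deterministic s.1.
Proof.
move=> ds sK x a y z xy xz; apply/eqP.
have : (y, z) \in s.2 by apply: ds; exists x, a.
by rewrite sK mem_fdiagonal => /andP[].
Qed.

(** An explicit description of the states that no step changes; the next two lemmas give the two
    directions. *)
Definition stable R s :=
  [/\ s.2 = fdiagonal (nodes s.1), complete s.1, deterministic s.1 &
      forall x u v, x \in nodes s.1 -> (u, v) \in R -> path_relation s.1 x u v].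

Lemma stable_TC_step R fresh s t : stable R s -> TC_step R fresh s t -> t = s.
Proof.
move=> [sK sc sd sR] [[x [a [xN [[_ ->//]|[[]]]]]]||].
- exact: sc.
- move=> [x [u [v [uv [xN [[]|[_ ->]]]]]]] //.
  + move=> [v1 [b [y [z [[_ _ xv nz] _]]]]].
    by case: nz; apply: sc; have [] := labels_path_nodes xv.
  + move=> [v1 [b [y [z [[_ _ xv nz] _]]]]].
    by case: nz; apply: sc; have [] := labels_path_nodes xv.
  + move=> [y [z [[xu xv] + _]]]; case.
    have [p [xu' xv']] := sR _ _ _ xN uv.
    by rewrite (labels_path_det sd xu xu') (labels_path_det sd xv xv').
- case: s t sK sc sd sR => [G K] [H L] /= -> _ sd _ [/= Gq least].
  (* Every node is its own minimum for the diagonal, so the quotient is the graph itself. *)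
  have GH : H = G.
    have fix_min x : x \in nodes G -> class_min (fdiagonal (nodes G)) x = x.
      exact: class_min_fdiagonal.
    apply: word_graph_eq; apply/fsetP.
      move=> x; apply/idP/idP => [/(quotient_nodeP _ Gq)[y yN ->]|xN].
        by rewrite fix_min.
      by apply/(quotient_nodeP _ Gq); exists x; rewrite ?fix_min.
    move=> [[x a] y]; apply/idP/idP => [|xy].
      move=> /(quotient_edgeP _ _ _ Gq)[x' [y' [xy -> ->]]].
      by have [xN yN] := edge_nodes xy; rewrite !fix_min.
    apply/(quotient_edgeP _ _ _ Gq); exists x, y.
    by have [xN yN] := edge_nodes xy; rewrite !fix_min.
  (* By determinism no pair of distinct nodes generates the new equivalence, which is therefore the
     diagonal. *)
  congr pair => //; apply: least_equivalence_eq least _; rewrite GH.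
  split; first exact: fdiagonal_equivalence.
    by move=> y z [yz [x [a [xy xz]]]]; case: yz; apply: sd xz.
  by move=> K' K'eq _; apply: fdiagonal_sub.
Qed.

(** For each property an output of some step is constructed and compared with the fixed state: TC1
    gives completeness, TC3 the trivial equivalence and determinism, TC2c the relations. *)
Lemma TC_step_stable R fresh s : equivalence_on (nodes s.1) s.2 ->
  (forall t, TC_step R fresh s t -> t = s) -> stable R s.
Proof.
case: s => [G K] /= Keq fixed.
have cG : complete G.
  move=> x a xN; apply: contrapT => xa.
  pose N := fresh |` nodes G; pose E := (x, a, fresh) |` edges G.
  have N0 : 0 \in N by rewrite !inE zero_node orbT.
  have EN : all (fun e => (e.1.1 \in N) && (e.2 \in N)) E.
    apply/allP => e; rewrite /E !inE => /predU1P[->|eE] /=.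
      by rewrite eqxx xN orbT.
    by have /andP[-> ->] := allP (edges_in_nodes G) _ eE; rewrite !orbT.
  have [GE _] : (WordGraph N0 EN, (fresh, fresh) |` K) = (G, K).
    by apply: fixed; apply: Or31; exists x, a; split=> //; right; split.
  by apply: xa; exists fresh; rewrite -GE fset1U1.
have Gfix : TC3 (G, K) (G, K).
  have [H Hq] := quotient_exists Keq.
  have [|L HL] := @least_equivalence_exists (nodes H)
      (fun y z => y <> z /\ ambiguous H y z).
    by move=> y z [_]; apply: ambiguous_nodes.
  have HG : (H, L) = (G, K) by apply: fixed; apply: Or33.
  by rewrite -{2}HG; split.
have [Gq _] := Gfix.
(* As [G] is its own quotient by [K], all its nodes are class minima; hence [K] is trivial. *)
have min_fixed x : x \in nodes G -> class_min K x = x.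
  by move=> /(quotient_nodeP _ Gq)[y yN]; apply: class_min_idem Keq yN.
have Kdiag : K = fdiagonal (nodes G).
  apply/eqP; rewrite eqEfsubset fdiagonal_sub// andbT; apply/fsubsetP=> -[x y].
  move=> xy; have [mem _ _ _] := Keq; have [xN yN] := mem _ _ xy.
  rewrite mem_fdiagonal xN -(min_fixed x)// -(min_fixed y)//.
  by rewrite (class_min_eq Keq xy) eqxx.
have dG : deterministic G.
  apply: (@detects_deterministic (G, K)) => //.
  exact: TC3_detects Gfix.
split=> // x u v xN uv.
have [y xu] := complete_path u cG xN; have [z xv] := complete_path v cG xN.
have [yz|/eqP yz] := eqVneq y z; first by exists y; split=> //; rewrite yz.
(* If the targets [y] and [z] differed, TC2c would put [(y, z)] into the equivalence, which is the
   diagonal. *)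
have [|L HL] := @least_equivalence_exists (nodes G)
    (fun p q => (p, q) \in K \/ (p = y /\ q = z)).
  move=> p q [|[-> ->]]; first by case: Keq => mem _ _ _; apply: mem.
  by have [_ ?] := labels_path_nodes xu; have [_ ?] := labels_path_nodes xv.
have [LK] : (G, L) = (G, K).
  apply: fixed; apply: Or32; exists x, u, v; split=> //; split=> //; left.
  by apply: Or33; exists y, z.
have [_ sub _] := HL; have /sub : (y, z) \in K \/ (y = y /\ z = z) by right.
by rewrite LK Kdiag mem_fdiagonal => /andP[_ /eqP].
Qed.

End Steps.

(** * Right actions of the free monoid and the universal property of A*/rho *)

Section Actions.
Context {disp : Order.disp_t} {A : finOrderType disp}.
Context (R S : {fset word A * word A}).
Implicit Types (u v w : word A).

Lemma word_quot_piP (q : word_quot R S) : exists u, q = \pi_(word_quot R S) u.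
Proof. by exists (repr q); rewrite reprK. Qed.

Lemma natural_action_right_action : right_action (@natural_action disp A R S).
Proof.
by split=> [x s t|x]; have [u ->] := word_quot_piP x;
   rewrite !natural_actionE ?cats0 ?catA.
Qed.

(** Here [sharp R] has to be two-sided: the representative of [x] multiplies on the left, which a
    right congruence need not respect. *)
Lemma natural_action_relation (x : word_quot R S) u v :
  (u, v) \in R -> natural_action x u = natural_action x v.
Proof.
move=> uv; apply/word_quot_eq => rho _ hR _; apply: hR => sigma [_ sc] h.
by have := sc _ _ (repr x) [::] (h _ _ uv); rewrite !cats0.
Qed.

Lemma natural_action_generator u v :
  (u, v) \in S -> \pi_(word_quot R S) u = \pi_(word_quot R S) v.
Proof. by move=> uv; apply/word_quot_eq => rho _ _; apply. Qed.

(* A*/rho is the free right action of the monoid presented by R on one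
   generator subject to S. *)
Lemma word_quot_universal (X : Type) (act : X -> word A -> X) (x0 : X) :
  right_action act ->
  (forall x u v, (u, v) \in R -> act x u = act x v) ->
  (forall u v, (u, v) \in S -> act x0 u = act x0 v) ->
  exists h : word_quot R S -> X,
    [/\ forall w, h (\pi_(word_quot R S) w) = act x0 w
      & forall q w, h (natural_action q w) = act (h q) w].
Proof.
move=> [actM act1] actR actS.
(* Having the same effect on [x0] is a right congruence. It contains [sharp R] because having the
   same effect on every point is a two-sided congruence containing R. *)
have sub u v : rcong R S u v -> act x0 u = act x0 v.
  move=> uv; apply: (uv (fun u v => act x0 u = act x0 v)) => [|x y xy|]; first 1 last.
  - apply: (xy (fun u v => forall z, act z u = act z v)) => [|x' y' R' z].
      split; first by split=> [//|x' y' h z|x' y' z h h' t]; rewrite h.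
      by move=> x' y' w w' h z; rewrite -!actM h.
    exact: actR.
  - exact: actS.
  - split; first by split=> [//|x y ->|x y z -> ->].
    by move=> x y w xy; rewrite -!actM xy.
have hE w : act x0 (repr (\pi_(word_quot R S) w)) = act x0 w.
  by apply: sub; apply/word_quot_eq; rewrite reprK.
exists (fun q => act x0 (repr q)); split=> // q w.
by rewrite /natural_action hE actM.
Qed.

(** Turns paths into an action by choice. It serves twice: for paths in the terminal graph and for
    eventual paths between immortal nodes. *)
Lemma functional_relation_action (X : Type) (P : X -> word A -> X -> Prop) :
  (forall x w, exists y, P x w y) ->
  (forall x w y z, P x w y -> P x w z -> y = z) ->
  (forall x, P x [::] x) ->
  (forall x u y v z, P x u y -> P y v z -> P x (u ++ v) z) ->
  exists2 act : X -> word A -> X,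
    right_action act & forall x w y, act x w = y <-> P x w y.
Proof.
move=> total fun_ P0 Pcat.
have /choice[f fP] : forall p : X * word A, exists y, P p.1 p.2 y.
  by move=> [x w]; apply: total.
have fE x w y : f (x, w) = y <-> P x w y.
  by split=> [<-|]; [apply: (fP (x, w)) | apply: fun_; apply: (fP (x, w))].
exists (fun x w => f (x, w)) => //; split=> [x s t|x]; last exact/fE.
by apply/esym/fE; apply: Pcat; [apply/fE | apply/fE].
Qed.

End Actions.

(** * Homomorphisms from word graphs to the Cayley graph of A*/rho *)

Section Labellings.
Context {disp : Order.disp_t} {A : finOrderType disp}.
Context (R S : {fset word A * word A}).
Implicit Types (s t : state A) (f : nat -> word_quot R S).

(* A homomorphism from the current word graph to the Cayley graph of A*/rho
   that identifies the nodes related by the current equivalence. *)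
Definition labelling f s :=
  [/\ f 0 = \pi_(word_quot R S) [::],
      forall x a y, (x, a, y) \in edges s.1 ->
        f y = natural_action (f x) [:: a]
    & forall x y, (x, y) \in s.2 -> f x = f y].

Lemma labelling_path f s x w y :
  labelling f s -> labels_path s.1 x w y -> f y = natural_action (f x) w.
Proof.
have [actM act1] := natural_action_right_action R S.
move=> [_ fE _]; elim: w x => [|a w IHw] x /= => [[_ <-]|]; first by rewrite act1.
by move=> [z /fE fz /IHw ->]; rewrite fz actM.
Qed.

(** A node goes to the class of some word leading to it from 0. Any two such words are related by
    rho because the path relation at 0 lies in rho. *)
Lemma labelling_initial s :
  reachable_from_zero s.1 ->
  (forall u v, path_relation s.1 0 u v -> rcong R S u v) ->
  s.2 = fdiagonal (nodes s.1) -> exists f, labelling f s.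
Proof.
move=> rs sound sK.
have /choice[h hP] x : exists w, x \in nodes s.1 -> labels_path s.1 0 w x.
  by have [/rs[w xw]|_] := boolP (x \in nodes s.1); [exists w | exists [::]].
exists (fun x => \pi_(word_quot R S) (h x)); split=> [|x a y xy|x y].
- apply/word_quot_eq; apply: sound; exists 0; split; first by apply: hP; apply: zero_node.
  by split=> //; apply: zero_node.
- rewrite natural_actionE; apply/word_quot_eq; apply: sound; exists y.
  have [xN yN] := edge_nodes xy; split; first exact: hP.
  by rewrite cats1; apply: labels_path_rcons xy; apply: hP.
- by rewrite sK mem_fdiagonal => /andP[_ /eqP ->].
Qed.

(** Only TC1 modifies [f], at the fresh node. An edge or coincidence from TC2 is respected because
    the relation holds in A*/rho, and TC3 because [f] is constant on the classes being merged. *)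
Lemma labelling_step fresh s t f :
  equivalence_on (nodes s.1) s.2 -> fresh \notin nodes s.1 ->
  enum_step (admissible R S) fresh s t ->
  labelling f s -> exists f', labelling f' t.
Proof.
move=> Keq nfresh st fs; have [f0 fE fK] := fs; have [mem _ _ _] := Keq.
have [actM act1] := natural_action_right_action R S.
have adm x u v : admissible R S x u v ->
    natural_action (f x) u = natural_action (f x) v.
  move=> [|[->]]; first exact: natural_action_relation.
  by rewrite f0 !natural_actionE; apply: natural_action_generator.
case: st => [->|x a xN xa tN tE tK|x u v b y z Q xu xv nzb tN tE tK
  |x u v y z Q xu xv tG least|[Gq least]]; first by exists f.
- have neq p : p \in nodes s.1 -> (p == fresh) = false.
    by move=> pN; apply: contraNF nfresh => /eqP <-.
  exists (fun p => if p == fresh then natural_action (f x) [:: a] else f p).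
  split=> [|p c q|p q]; first by rewrite neq ?zero_node.
    rewrite tE !inE => /predU1P[[-> -> ->]|pq]; first by rewrite eqxx neq.
    by have [pN qN] := edge_nodes pq; rewrite !neq//; apply: fE.
  rewrite tK !inE => /predU1P[[-> ->]//|pq].
  by have [pN qN] := mem _ _ pq; rewrite !neq//; apply: fK.
- exists f; split=> //; last by rewrite tK.
  move=> p c q; rewrite tE !inE => /predU1P[[-> -> ->]|]; last exact: fE.
  rewrite (labelling_path fs xu) (labelling_path fs xv) actM cats1.
  by case: Q => /adm.
- exists f; split=> //; first by rewrite tG.
  apply: least_equivalence_kernel least _ _ => p q [pq|[-> ->]].
  + exact: mem.
  + by have [_ ?] := labels_path_nodes xu; have [_ ?] := labels_path_nodes xv.
  + exact: fK.
  + by rewrite (labelling_path fs xu) (labelling_path fs xv) (adm _ _ _ Q).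
- have tE x a y : (x, a, y) \in edges t.1 -> f y = natural_action (f x) [:: a].
    move=> /(quotient_edgeP _ _ _ Gq)[x' [y' [xy -> ->]]].
    have [xN yN] := edge_nodes xy.
    rewrite -(fK _ _ (class_min_mem Keq xN)) -(fK _ _ (class_min_mem Keq yN)).
    exact: fE.
  exists f; split=> //; apply: least_equivalence_kernel least _ _ => p q [_].
  + exact: ambiguous_nodes.
  + by move=> [x [a [/tE -> /tE ->]]].
Qed.

End Labellings.

(** * Invariants along an enumeration, and the action on a terminal graph *)

Section EnumerationInvariants.
Context {disp : Order.disp_t} {A : finOrderType disp}.
Context (R S : {fset word A * word A}) (m : nat) (st : nat -> state A).
Context (enum : congruence_enumeration R S m st).
Implicit Types (u v w : word A) (x y z : nat) (s t : state A).

Lemma enumeration_equivalence i : equivalence_on (nodes (st i).1) (st i).2.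
Proof.
elim: i => [|i]; last by apply: enum_step_equivalence (enumeration_step i enum).
by have [[_ K0] _ _ _] := enum; rewrite K0; apply: fdiagonal_equivalence.
Qed.

Lemma enumeration_reachable i :
  reachable_from_zero (st 0).1 -> reachable_from_zero (st i).1.
Proof.
move=> r0; elim: i => // i; apply: enum_step_reachable (enumeration_step i enum).
exact: enumeration_equivalence.
Qed.

Lemma new_node_fresh i : new_node st i \notin nodes (st i).1.
Proof.
apply/negP => xN; suff : new_node st i < new_node st i by rewrite ltnn.
rewrite {2}/new_node ltnS.
apply: leq_trans (leq_bigmax (ord_max : 'I_i.+1)).
exact: (@leq_bigmax_seq _ _ predT id).
Qed.

Lemma enumeration_labelling i :
  reachable_from_zero (st 0).1 -> exists f, labelling (R := R) (S := S) f (st i).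
Proof.
move=> r0; have [[sound K0] _ _ _] := enum.
elim: i => [|i [f]]; first exact: labelling_initial.
apply: labelling_step (enumeration_step i enum).
  exact: enumeration_equivalence.
exact: new_node_fresh.
Qed.

Lemma enumeration_map i : exists g : nat -> nat,
    [/\ forall x, g x <= x,
        forall x w y, labels_path (st i).1 x w y ->
          labels_path (st i.+1).1 (g x) w (g y),
        forall x y, (x, y) \in (st i).2 -> (g x, g y) \in (st i.+1).2
      & forall x, x \in nodes (st i).1 -> x \in nodes (st i.+1).1 -> g x = x].
Proof.
have [g [gle gN gE gK gid]] :=
  enum_step_map (enumeration_equivalence i) (enumeration_step i enum).
by exists g; split=> // x w y; apply: labels_path_map.
Qed.

Lemma enumeration_path u i j : i <= j ->
  (exists y, labels_path (st i).1 0 u y) ->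
  exists y, labels_path (st j).1 0 u y.
Proof.
move=> ij [y uy]; elim: j ij => [|j IHj].
  by rewrite leqn0 => /eqP i0; exists y; rewrite i0 in uy.
rewrite leq_eqVlt => /predU1P[<-|/IHj[{uy}y uy]]; first by exists y.
have [g [gle gpath _ _]] := enumeration_map j.
have g0 : g 0 = 0 by apply/eqP; rewrite -leqn0.
by exists (g y); rewrite -[0]g0; apply: gpath.
Qed.

(** TC2 may merely record a coincidence, so the targets are required to be related rather than
    equal. In this form the condition survives all later steps. *)
Definition joined s u v :=
  exists y z, [/\ labels_path s.1 0 u y, labels_path s.1 0 v z
                & (y, z) \in s.2].

Lemma joined_mono u v i j :
  i <= j -> joined (st i) u v -> joined (st j) u v.
Proof.
move=> ij uv; elim: j ij => [|j IHj]; first by rewrite leqn0 => /eqP i0; rewrite i0 in uv.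
rewrite leq_eqVlt => /predU1P[<-//|/IHj[y [z [uy vz yz]]]].
have [g [gle gpath gK _]] := enumeration_map j.
have g0 : g 0 = 0 by apply/eqP; rewrite -leqn0.
by exists (g y), (g z); split; rewrite -1?[0]g0; [apply: gpath..|apply: gK].
Qed.

Lemma TC2_joined s t u v :
  equivalence_on (nodes s.1) s.2 -> equivalence_on (nodes t.1) t.2 ->
  (exists y, labels_path s.1 0 u y) -> (exists z, labels_path s.1 0 v z) ->
  TC2 0 u v s t -> joined t u v.
Proof.
move=> [mem _ _ _] [_ r _ _] [y uy] [z vz] [_ []]; last first.
  move=> [none tE]; have [yz|/eqP yz] := eqVneq y z.
    rewrite tE in r *; exists y, z; split=> //; rewrite -yz; apply: r.
    by have [] := labels_path_nodes uy.
  (* With distinct targets TC2c has an output, contradicting [none]. *)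
  have [|K sK] := @least_equivalence_exists (nodes s.1)
    (fun p q => (p, q) \in s.2 \/ (p = y /\ q = z)).
    move=> p q [/mem //|[-> ->]]; have [_ yN] := labels_path_nodes uy.
    by have [_ zN] := labels_path_nodes vz.
  by case: (none (s.1, K)); apply: Or33; exists y, z.
have edge u1 b p q u' : labels_path s.1 0 u' p ->
  labels_path s.1 0 u1 q -> nodes t.1 = nodes s.1 ->
  edges t.1 = (q, b, p) |` edges s.1 ->
  [/\ labels_path t.1 0 u' p, labels_path t.1 0 (rcons u1 b) p & (p, p) \in t.2].
  move=> u'p u1q tN tE; split.
  - by apply: labels_path_sub u'p; rewrite ?tN ?tE ?fsubsetUr.
  - apply: (@labels_path_rcons _ _ _ _ _ _ q); last by rewrite tE fset1U1.
    by apply: labels_path_sub u1q; rewrite ?tN ?tE ?fsubsetUr.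
  - by apply: r; rewrite tN; have [] := labels_path_nodes u'p.
case.
- move=> [v1 [b [p [q [[-> up vq _] [tN tE _]]]]]].
  by have [] := edge _ _ _ _ _ up vq tN tE; exists p, p.
- move=> [u1 [b [p [q [[-> vp uq _] [tN tE _]]]]]].
  by have [] := edge _ _ _ _ _ vp uq tN tE; exists p, p.
- move=> [p [q [[up vq _] [tG [_ sub _]]]]]; exists p, q; rewrite tG.
  by split=> //; apply: sub; right.
Qed.

Lemma enumeration_joined u v i : (u, v) \in S -> m <= i -> joined (st i) u v.
Proof.
move=> uvS mi; have [_ [p [l [_ paths lS mE hTC2]]] _ _] := enum.
have [y [z [uy vz]]] := paths _ _ uvS.
rewrite -(perm_mem lS) in uvS.
have kl : index (u, v) l < size l by rewrite index_mem.
(* The state just after TC2 has been applied to [(u, v)]. *)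
apply: (@joined_mono _ _ (p + index (u, v) l).+1).
  by rewrite (leq_trans _ mi)// mE -addnS leq_add2l.
have := hTC2 _ kl; rewrite /= nth_index//=; apply: TC2_joined.
- exact: enumeration_equivalence.
- exact: enumeration_equivalence.
- by apply: enumeration_path (leq_addr _ _) _; exists y.
- by apply: enumeration_path (leq_addr _ _) _; exists z.
Qed.

Lemma terminates_stable i : terminates_at R m st i -> stable R (st i).
Proof.
by move=> [_ fixed]; apply: TC_step_stable fixed; apply: enumeration_equivalence.
Qed.

Lemma terminal_action i :
  reachable_from_zero (st 0).1 -> terminates_at R m st i ->
  let G := (st i).1 in
  finite_set [set: word_quot R S] /\
  exists phi : nodes G -> word A -> nodes G,
    [/\ forall (x : nodes G) (w : word A) (y : nodes G),
          phi x w = y <-> labels_path G (val x) w (val y),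
        right_action phi
      & action_isomorphic phi (@natural_action disp A R S)].
Proof.
move=> r0 ti G; have [mi _] := ti.
have [Kdiag cG dG RG] := terminates_stable ti.
have rG := enumeration_reachable (i := i) r0; rewrite -/G in cG dG RG rG.
have [||||phi phi_act phiE] := @functional_relation_action _ A (nodes G)
    (fun (x : nodes G) w (y : nodes G) => labels_path G (val x) w (val y)).
- move=> x w; have [y xy] := complete_path w cG (valP x).
  by have [_ yN] := labels_path_nodes xy; exists [` yN].
- by move=> x w y z xy xz; apply/val_inj/(labels_path_det dG xy xz).
- by move=> x; split; first exact: valP.
- by move=> x u y v z xy yz; apply/labels_path_cat; exists (val y).
pose x0 : nodes G := [` zero_node G].
have [x u v uv|u v uv|h [hpi hact]] := @word_quot_universal _ _ R S _ phi x0 phi_act.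
- have [y [xu xv]] := RG _ _ _ (valP x) uv.
  have [_ yN] := labels_path_nodes xu.
  have /phiE -> : labels_path G (val x) u (val [` yN]) by [].
  by apply/esym/phiE.
(* The equivalence is trivial here, so the related targets coincide. *)
- have [y [z [uy vz]]] := enumeration_joined uv mi.
  rewrite Kdiag mem_fdiagonal => /andP[yN /eqP yz]; subst z.
  have /phiE -> : labels_path G (val x0) u (val [` yN]) by [].
  by apply/esym/phiE.
have [f fs] := enumeration_labelling i r0; have [f0 _ _] := fs.
pose lambda (x : nodes G) := f (val x).
have lambda_act (x : nodes G) w : lambda (phi x w) = natural_action (lambda x) w.
  by apply: labelling_path fs _; apply/phiE.
(* By reachability each node is [phi x0 w] for some [w]; equivariance then reduces the claim to
   [x0], which corresponds to the class of the empty word. *)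
have lambdaK : cancel lambda h.
  move=> x; have [w /(phiE x0 w x) <-] := rG _ (valP x).
  by rewrite lambda_act /lambda f0 natural_actionE hpi.
have hK : cancel h lambda.
  move=> q; have [w ->] := word_quot_piP q.
  by rewrite hpi lambda_act /lambda f0 natural_actionE.
split.
  have -> : [set: word_quot R S]%classic = (lambda @` [set: nodes G])%classic.
    by apply/esym/seteqP; split=> // q _; exists (h q).
  by apply: finite_image; apply: finite_finset.
exists phi; split=> //; exists lambda => //.
by exists h.
Qed.

End EnumerationInvariants.

(** * Eventual behaviour of an enumeration, and termination *)

Lemma nonincreasing_stabilizes (f : nat -> nat) :
  (forall n, f n.+1 <= f n) -> exists i, forall j, i <= j -> f j = f i.
Proof.
move=> fS.
have mono i j : i <= j -> f j <= f i.
  elim: j => [|j IHj]; first by rewrite leqn0 => /eqP ->.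
  rewrite leq_eqVlt => /predU1P[->//|ij].
  exact: leq_trans (fS _) (IHj ij).
have ex : exists k, `[< exists n, f n = k >] by exists (f 0); apply/asboolP; exists 0.
case: (ex_minnP ex) => k /asboolP[i fi] kmin; exists i => j ij.
apply/eqP; rewrite eqn_leq mono// fi kmin//.
by apply/asboolP; exists j.
Qed.

Section Termination.
Context {disp : Order.disp_t} {A : finOrderType disp}.
Context (R S : {fset word A * word A}) (m : nat) (st : nat -> state A).
Context (enum : congruence_enumeration R S m st).
Context (reach : reachable_from_zero (st 0).1).
Context (det : deterministic (st 0).1 \/ exists i, TC3 (st i) (st i.+1)).
Implicit Types (u v w : word A) (x y z : nat) (a : A).

(** A deterministic input has only trivial ambiguities, and any TC3 records all of those in its
    output; from then on the property is preserved. *)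
Lemma enumeration_detects :
  exists i, forall j, i <= j -> detects_coincidences (st j).
Proof.
have [i di] : exists i, detects_coincidences (st i).
  case: det => [d0|[i /TC3_detects di]]; last by exists i.+1.
  exists 0 => y z [x [a [xy xz]]]; have [[_ ->] _ _ _] := enum.
  rewrite mem_fdiagonal (d0 _ _ _ _ xy xz) eqxx andbT.
  by have [] := edge_nodes xz.
exists i; elim=> [|j IHj]; first by rewrite leqn0 => /eqP i0; rewrite i0 in di.
rewrite leq_eqVlt => /predU1P[<-//|/IHj].
apply: enum_step_detects (enumeration_step j enum).
exact: enumeration_equivalence enum j.
Qed.

Lemma diagonal_infinitely_often i :
  exists2 j, i <= j & (st j).2 = fdiagonal (nodes (st j).1).
Proof.
have [_ _ _ fair] := enum; have [_ _ fairK] := fair _ (leq_maxl m i).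
have [/eqP K|/eqP /fairK[j ij K]] :=
  boolP ((st (maxn m i)).2 == fdiagonal (nodes (st (maxn m i)).1)).
  by exists (maxn m i) => //; apply: leq_maxr.
by exists j => //; apply: leq_trans ij; apply: leq_maxr.
Qed.

Lemma deterministic_infinitely_often i :
  exists2 j, i <= j & (st j).2 = fdiagonal (nodes (st j).1) /\
                      deterministic (st j).1.
Proof.
have [d dj] := enumeration_detects.
have [j] := diagonal_infinitely_often (maxn i d).
rewrite geq_max => /andP[ij dij] K; exists j => //; split=> //.
exact: detects_deterministic (dj _ dij) K.
Qed.

Definition immortal_from i x := forall j, i <= j -> x \in nodes (st j).1.
Definition immortal x := exists i, immortal_from i x.

(** These play the part of paths in a limit graph on the immortal nodes; the time from which a path
    persists may depend on the path. *)
Definition eventual_path x w y :=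
  exists i, forall j, i <= j -> labels_path (st j).1 x w y.

Lemma immortal0 : immortal_from 0 0.
Proof. by move=> j _; apply: zero_node. Qed.

Lemma eventual_path_immortal x w y : eventual_path x w y -> immortal y.
Proof.
by move=> [i xy]; exists i => j /xy xyj; have [] := labels_path_nodes xyj.
Qed.

Lemma eventual_path_uniq x w y z :
  eventual_path x w y -> eventual_path x w z -> y = z.
Proof.
move=> [i xy] [k xz].
have [j] := deterministic_infinitely_often (maxn i k).
rewrite geq_max => /andP[ij kj] [_ dj].
exact: labels_path_det dj (xy _ ij) (xz _ kj).
Qed.

Lemma eventual_path_cat x u y v z :
  eventual_path x u y -> eventual_path y v z -> eventual_path x (u ++ v) z.
Proof.
move=> [i xy] [k yz]; exists (maxn i k) => j.
rewrite geq_max => /andP[ij kj]; apply/labels_path_cat; exists y.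
  exact: xy.
exact: yz.
Qed.

(* The number of a node only decreases as the node is merged, so it is
   eventually constant. *)
Lemma limit_node i : exists lim : nat -> nat,
  (forall x w y, immortal_from i x -> labels_path (st i).1 x w y ->
     eventual_path x w (lim y)) /\
  (forall y z, (y, z) \in (st i).2 -> lim y = lim z).
Proof.
have /choice[g gP] := enumeration_map enum.
(* [push k x] follows [x] through the [k] steps after state [i]; from [t x] steps on it is
   constant. *)
pose fix push k x {struct k} :=
  if k is k'.+1 then g (i + k')%N (push k' x) else x.
have /choice[t tP] y : exists k, forall j, k <= j -> push j y = push k y.
  by apply: nonincreasing_stabilizes => n /=; have [] := gP (i + n)%N.
have pushP y j : (i + t y)%N <= j -> push (j - i) y = push (t y) y.
  by move=> tj; apply: tP; rewrite leq_subRL// (leq_trans (leq_addr _ _) tj).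
exists (fun y => push (t y) y); split=> [x w y xi xy|y z yz].
  (* The source stays [x], since the step maps fix a surviving node; only the target moves. *)
  have push_path k : labels_path (st (i + k)%N).1 x w (push k y).
    elim: k => [|k IHk]; first by rewrite addn0.
    have [_ gpath _ gid] := gP (i + k)%N.
    rewrite addnS -{1}(gid x); first exact: gpath.
      by apply: xi; rewrite leq_addr.
    by apply: xi; rewrite -addnS leq_addr.
  exists (i + t y)%N => j tj; rewrite -(pushP _ _ tj).
  have ij : i <= j by apply: leq_trans tj; apply: leq_addr.
  by have := push_path (j - i); rewrite subnKC.
have push_eq k : (push k y, push k z) \in (st (i + k)%N).2.
  elim: k => [|k IHk]; first by rewrite addn0.
  by rewrite addnS; have [_ _ gK _] := gP (i + k)%N; apply: gK.
(* The images of [y] and [z] remain related, and at a late state with trivial equivalence they are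
   equal. *)
have [j] := diagonal_infinitely_often (maxn (i + t y)%N (i + t z)%N).
rewrite geq_max => /andP[yj zj] Kj; have := push_eq (j - i).
rewrite subnKC; last by apply: leq_trans yj; apply: leq_addr.
by rewrite Kj mem_fdiagonal !pushP// => /andP[_ /eqP].
Qed.

Lemma immortal_from_m x : immortal x -> exists2 i, m <= i & immortal_from i x.
Proof.
move=> [i xi]; exists (maxn m i); first exact: leq_maxl.
by move=> j; rewrite geq_max => /andP[_]; apply: xi.
Qed.

Lemma immortal_from_le i j x : i <= j -> immortal_from i x -> immortal_from j x.
Proof. by move=> ij xi k jk; apply: xi; apply: leq_trans jk. Qed.

(** An immortal node cannot take the alternative of vanishing in the fairness condition, so it
    acquires the edge at some time; the limit of the target makes that edge eventual. *)
Lemma eventual_path_total x w : immortal x -> exists y, eventual_path x w y.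
Proof.
elim: w x => [|a w IHw] x xI; first by have [i xi] := xI; exists x, i => j /xi.
have [i mi xi] := immortal_from_m xI; have [_ _ _ fair] := enum.
have [j ij [y xy]] : exists2 j, i <= j & has_edge (st j).1 x a.
  have [xa|xa] := pselect (has_edge (st i).1 x a); first by exists i.
  have [fairE _ _] := fair _ mi.
  have [j ij [|xj]] := fairE _ _ (xi _ (leqnn i)) xa; last by exists j.
  by rewrite xi.
have [lim [lim_path _]] := limit_node j.
have {}xy : eventual_path x [:: a] (lim y).
  by apply: lim_path (immortal_from_le ij xi) _; apply/labels_path1.
have [z yz] := IHw _ (eventual_path_immortal xy).
by exists z; apply: eventual_path_cat xy yz.
Qed.

Lemma eventual_path_relation x u v : immortal x -> (u, v) \in R ->
  exists y, eventual_path x u y /\ eventual_path x v y.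
Proof.
move=> /immortal_from_m[i mi xi] uv; have [_ _ _ fair] := enum.
have [_ fairR _] := fair _ mi.
have [j ij [|[y [xu xv]]]] := fairR _ _ _ (xi _ (leqnn i)) uv.
  by rewrite xi.
have [lim [lim_path _]] := limit_node j.
have xj := immortal_from_le ij xi.
by exists (lim y); split; apply: lim_path.
Qed.

Lemma eventual_path_generator u v : (u, v) \in S ->
  exists y, eventual_path 0 u y /\ eventual_path 0 v y.
Proof.
move=> /(enumeration_joined enum)/(_ (leqnn m))[y [z [uy vz yz]]].
have [lim [lim_path lim_eq]] := limit_node m.
have im : immortal_from m 0 by apply: immortal_from_le immortal0.
exists (lim y); split; first exact: lim_path.
by rewrite (lim_eq _ _ yz); apply: lim_path.
Qed.

(** The universal property, applied to the action of words on immortal nodes with base point 0. *)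
Lemma eventual_cayley_graph : exists X : word_quot R S -> nat,
  X (\pi_(word_quot R S) [::]) = 0 /\
  forall q w, eventual_path (X q) w (X (natural_action q w)).
Proof.
pose I := {x : nat | `[< immortal x >]}.
pose P (x : I) w (y : I) := eventual_path (val x) w (val y).
have mkI x w y : eventual_path x w y -> `[< immortal y >].
  by move=> xy; apply/asboolP/(eventual_path_immortal xy).
have I0 : `[< immortal 0 >] by apply/asboolP; exists 0; apply: immortal0.
pose x0 : I := exist _ 0 I0.
have [||||act act_act actE] := @functional_relation_action _ A I P.
- move=> [x xI] w; have [y xy] := eventual_path_total w (asboolW xI).
  by exists (exist _ y (mkI _ _ _ xy)).
- by move=> x w y z xy xz; apply/val_inj/(eventual_path_uniq xy xz).
- by move=> [x xI]; have [i xi] := asboolW xI; exists i => j /xi.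
- by move=> x u y v z; apply: eventual_path_cat.
have same (x : I) u v : (exists y, eventual_path (val x) u y /\
    eventual_path (val x) v y) -> act x u = act x v.
  move=> [y [xu xv]].
  have /actE -> : P x u (exist _ y (mkI _ _ _ xu)) by [].
  exact/esym/actE.
have [|u v uv|h [hpi hact]] := @word_quot_universal _ _ R S _ act x0 act_act.
- move=> x u v uv; apply: same; apply: eventual_path_relation => //.
  exact: asboolW (valP x).
- by apply: same; apply: eventual_path_generator.
exists (fun q => val (h q)); split; first by rewrite hpi (proj2 act_act).
by move=> q w; rewrite hact; apply/actE.
Qed.

Lemma enumeration_terminates :
  finite_set [set: word_quot R S] -> exists i, terminates_at R m st i.
Proof.
move=> /finite_seqP[s sE].
have in_s q : q \in s by have : [set: word_quot R S]%classic q by []; rewrite sE.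
have [X [X0 XP]] := eventual_cayley_graph.
have /choice[t tP] : forall p : word_quot R S * A, exists i, forall j, i <= j ->
    labels_path (st j).1 (X p.1) [:: p.2] (X (natural_action p.1 [:: p.2])).
  by move=> [q a]; apply: XP.
(* The finitely many edges of the image of the Cayley graph are all present from time [T] on; this
   uses that both A*/rho and A are finite. *)
pose T := maxn m (\max_(q <- s) \max_a t (q, a)).
have [j Tj [Kj dj]] := deterministic_infinitely_often T.
have edgeX q a :
    labels_path (st j).1 (X q) [:: a] (X (natural_action q [:: a])).
  apply: (tP (q, a)); apply: leq_trans Tj; apply: leq_trans (leq_maxr _ _).
  apply: (leq_trans (@leq_bigmax _ (fun a => t (q, a)) a)).
  exact: (@leq_bigmax_seq _ s predT (fun q => \max_a t (q, a)) q).
have nodeXq q : X q \in nodes (st j).1.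
  have [w ->] := word_quot_piP q; elim/last_ind: w => [|w a IHw].
    by rewrite X0; apply: zero_node.
  rewrite -cats1 -natural_actionE.
  by have [] := labels_path_nodes (edgeX (\pi_(word_quot R S) w) a).
have pathX w q : labels_path (st j).1 (X q) w (X (natural_action q w)).
  have [actM act1] := natural_action_right_action R S.
  elim: w q => [|a w IHw] q; last first.
    rewrite -cat1s -actM; apply/labels_path_cat.
    by exists (X (natural_action q [:: a])).
  by rewrite act1.
(* A word leading from 0 to [x] also labels a path inside the image, and by determinism both paths
   end at the same node. *)
have nodeX x : x \in nodes (st j).1 -> exists q, x = X q.
  move=> /(enumeration_reachable enum reach)[w xw].
  exists (natural_action (\pi_(word_quot R S) [::]) w).
  by apply: labels_path_det dj xw _; rewrite -[in labels_path _ 0]X0.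
have mj : m <= j by apply: leq_trans Tj; apply: leq_maxl.
exists j; split=> // t'; apply: stable_TC_step; split=> //.
- by move=> _ a /nodeX[q ->]; exists (X (natural_action q [:: a])); apply/labels_path1.
- move=> _ u v /nodeX[q ->] uv; exists (X (natural_action q u)); split=> //.
  by rewrite (natural_action_relation q uv).
Qed.

End Termination.

Theorem theorem4p1 (disp : Order.disp_t) (A : finOrderType disp)
    (R S : {fset word A * word A}) :
  (forall (m : nat) (st : nat -> state A) (i : nat),
     congruence_enumeration R S m st ->
     reachable_from_zero (st 0).1 ->
     terminates_at R m st i ->
     let G := (st i).1 in
     finite_set [set: word_quot R S] /\
     exists phi : nodes G -> word A -> nodes G,
       [/\ forall (x : nodes G) (w : word A) (y : nodes G),
             phi x w = y <-> labels_path G (val x) w (val y),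
           right_action phi
         & action_isomorphic phi (@natural_action disp A R S)]) /\
  (finite_set [set: word_quot R S] ->
   forall (m : nat) (st : nat -> state A),
     congruence_enumeration R S m st ->
     reachable_from_zero (st 0).1 ->
     deterministic (st 0).1 \/ (exists i : nat, TC3 (st i) (st i.+1)) ->
     exists i : nat, terminates_at R m st i).
Proof.
split=> [m st i enum reach ti|fin m st enum reach det].
  exact: (terminal_action enum reach ti).
exact: enumeration_terminates enum reach det fin.
Qed.
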